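(* Let $X\subset\mathbb{P}^{s-1}$ be the algebraic toric set over $K=\mathbb{F}_q$ parameterized by $\nu_1,\dots,\nu_s\in\mathbb{N}^n$, and let $I(X)\subset S=K[t_1,\dots,t_s]$ be its vanishing ideal. There exists a set of generators of $I(X)$ which consists of the toric relations $t_i^{q-1}-t_j^{q-1}$ ($1\le i,j\le s$) plus a finite set of homogeneous binomials $t^a-t^b$ with $\operatorname{supp}(a)\cap\operatorname{supp}(b)=\emptyset$ and such that the degree of $t^a-t^b$ in each of the variables $t_i$ is $\leq q-2$.
   Context: $K=\mathbb{F}_q$ is a finite field with $q>2$ elements and $K^*=K\setminus\{0\}$. $\mathbb{P}^{s-1}$ is the projective space of dimension $s-1$ over $K$ (classes $[\mathbf{x}]$ of nonzero vectors of $K^s$ modulo scalars in $K^*$). For $\nu=(r_1,\dots,r_n)\in\mathbb{N}^n$ and $\mathbf{x}=(x_1,\dots,x_n)\in(K^* )^n$ put $\mathbf{x}^\nu=x_1^{r_1}\cdots x_n^{r_n}$. The algebraic toric set parameterized by $\nu_1,\dots,\nu_s\in\mathbb{N}^n$ is $X=\{[(\mathbf{x}^{\nu_1},\dots,\mathbf{x}^{\nu_s})]:\mathbf{x}\in(K^* )^n\}\subset\mathbb{P}^{s-1}$. $S=K[t_1,\dots,t_s]$ has the standard grading, and $I(X)$ is the ideal of $S$ generated by the homogeneous polynomials vanishing on $X$. For $a=(a_1,\dots,a_s)\in\mathbb{N}^s$, $t^a=t_1^{a_1}\cdots t_s^{a_s}$ and $\operatorname{supp}(a)=\{i: a_i\neq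 0\}$. A binomial is a polynomial of the form $t^a-t^b$ with $a,b\in\mathbb{N}^s$. *)

(* Defs.v *)
From HB Require Import structures.
From mathcomp Require Import all_boot all_order all_algebra.
From mathcomp Require Export mpoly.

Set Implicit Arguments.
Unset Strict Implicit.
Unset Printing Implicit Defensive.

Import GRing.Theory.
Local Open Scope ring_scope.

(* A point of the projective space is represented by its equivalence class,
   i.e. the set of all K^*-multiples of a nonzero vector. *)
Definition proj_class (K : finFieldType) (s : nat) (x : 'rV[K]_s) :
    {set 'rV[K]_s} :=
  [set c *: x | c : K & c != 0].

Definition proj_space (K : finFieldType) (s : nat) : {set {set 'rV[K]_s}} :=
  [set proj_class x | x : 'rV[K]_s & x != 0].

Definition monomial_value (K : finFieldType) (n : nat) (x : 'rV[K]_n)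
    (r : 'X_{1..n}) : K :=
  \prod_(k < n) x 0 k ^+ r k.

Definition toric_vector (K : finFieldType) (n s : nat)
    (nu : 'I_s -> 'X_{1..n}) (x : 'rV[K]_n) : 'rV[K]_s :=
  \row_(i < s) monomial_value x (nu i).

Definition torus (K : finFieldType) (n : nat) : {set 'rV[K]_n} :=
  [set x : 'rV[K]_n | [forall k, x 0 k != 0]].

Definition toric_set (K : finFieldType) (n s : nat)
    (nu : 'I_s -> 'X_{1..n}) : {set {set 'rV[K]_s}} :=
  [set proj_class (toric_vector nu x) | x in torus K n].

Lemma toric_set_sub (K : finFieldType) (n s : nat) (nu : 'I_s -> 'X_{1..n}) :
  (0 < s)%N -> toric_set K nu \subset proj_space K s.
Proof.
move=> s_gt0; apply/subsetP => P /imsetP[x]; rewrite inE => /forallP x_neq0 ->.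
apply/imsetP; exists (toric_vector nu x) => //; rewrite inE.
apply/eqP => /rowP/(_ (Ordinal s_gt0)); rewrite !mxE => /eqP.
by apply/negP/prodf_neq0 => k _; rewrite expf_neq0.
Qed.

Definition homogeneous (R : nzRingType) (s : nat) (f : {mpoly R[s]}) : Prop :=
  exists d : nat, f \is d.-homog.

(* Vanishing is required at every representative of every point of X; for
   homogeneous f this does not depend on the representative. *)
Definition vanishes_on (K : finFieldType) (s : nat) (X : {set {set 'rV[K]_s}})
    (f : {mpoly K[s]}) : Prop :=
  forall P, P \in X -> forall x : 'rV[K]_s, x \in P ->
    f.@[fun i => x 0 i] = 0.

Definition ideal_gen (R : comNzRingType) (G : R -> Prop) (f : R) : Prop :=
  exists2 r : seq (R * R),
    (forall p, p \in r -> G p.2) & f = \sum_(p <- r) p.1 * p.2.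

Definition vanishing_ideal (K : finFieldType) (s : nat)
    (X : {set {set 'rV[K]_s}}) : {mpoly K[s]} -> Prop :=
  ideal_gen (fun f => homogeneous f /\ vanishes_on X f).

Definition toric_relation (K : finFieldType) (s : nat) (f : {mpoly K[s]}) :
    Prop :=
  exists i j : 'I_s, f = 'X_i ^+ (#|K| - 1) - 'X_j ^+ (#|K| - 1).

Definition supp (s : nat) (a : 'X_{1..s}) : {set 'I_s} :=
  [set i | a i != 0%N].

Definition degree_in (R : nzRingType) (s : nat) (i : 'I_s) (f : {mpoly R[s]}) :
    nat :=
  \max_(m <- msupp f) m i.

(* Main.v *)
Require Import Defs.
From mathcomp Require Import all_boot all_order all_algebra finfield.
Import GRing.Theory.
Local Open Scope ring_scope.

(** The monomials restrict to characters of the torus, and distinct characters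
    are linearly independent, so a homogeneous polynomial vanishing on [X] is a
    linear combination of homogeneous binomials [t^a - t^b] vanishing on [X].
    Common variables can be cancelled from such a binomial, as they do not
    vanish on [X]. If [t^a] is then divisible by [t_i^(q-1)], the binomial is
    nonconstant and homogeneous, so some [t_j] divides [t^b]; modulo
    [t_i^(q-1) - t_j^(q-1)] the factor [t_i^(q-1)] becomes [t_j^(q-1)], and
    [t_j] can be cancelled, which lowers the degree. The descent ends at the
    finitely many binomials with disjoint supports and exponents [<= q-2]. *)

(** * Ideals generated by a predicate *)

Section IdealGen.
Variables (R : comNzRingType) (G : R -> Prop).

Lemma ideal_gen0 : ideal_gen G 0.
Proof. by exists [::]; rewrite ?big_nil. Qed.

Lemma ideal_genD f g : ideal_gen G f -> ideal_gen G g -> ideal_gen G (f + g).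
Proof.
move=> [r rG ->] [r' r'G ->]; exists (r ++ r'); last by rewrite big_cat.
by move=> p; rewrite mem_cat => /orP[/rG|/r'G].
Qed.

Lemma ideal_genM h f : ideal_gen G f -> ideal_gen G (h * f).
Proof.
move=> [r rG ->]; exists [seq (h * p.1, p.2) | p <- r].
  by move=> _ /mapP[p /rG Gp ->].
by rewrite big_map mulr_sumr; apply: eq_bigr => p _; rewrite mulrA.
Qed.

Lemma ideal_genN f : ideal_gen G f -> ideal_gen G (- f).
Proof. by rewrite -mulN1r; apply: ideal_genM. Qed.

Lemma mem_ideal_gen f : G f -> ideal_gen G f.
Proof.
move=> Gf; exists [:: (1, f)]; last by rewrite big_seq1 mul1r.
by move=> p; rewrite inE => /eqP->.
Qed.

Lemma ideal_gen_sum (I : eqType) (r : seq I) (F : I -> R) :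
  (forall i, i \in r -> ideal_gen G (F i)) ->
  ideal_gen G (\sum_(i <- r) F i).
Proof.
move=> GF; rewrite big_seq; elim/big_rec: _ => [|i f ir Gf].
  exact: ideal_gen0.
exact: ideal_genD (GF i ir) Gf.
Qed.

(** Reduces an inclusion of ideals to a check on generators; both inclusions of the theorem are
    obtained this way. *)
Lemma ideal_gen_trans (H : R -> Prop) f :
  (forall g, H g -> ideal_gen G g) -> ideal_gen H f -> ideal_gen G f.
Proof.
move=> HG [r rH ->]; apply: ideal_gen_sum => p /rH/HG; exact: ideal_genM.
Qed.

End IdealGen.

(** * Character sums and the order of the torus *)

Section Torus.
Variables (K : finFieldType) (n : nat).
Implicit Types x y : 'rV[K]_n.

Definition torus_mul x y : 'rV[K]_n := \row_k (x 0 k * y 0 k).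

Lemma torusP x : reflect (forall k, x 0 k != 0) (x \in torus K n).
Proof. by rewrite inE; apply: forallP. Qed.

Lemma torus_mul_in x y :
  y \in torus K n -> (torus_mul y x \in torus K n) = (x \in torus K n).
Proof.
move/torusP=> y0; apply/torusP/torusP => x0 k; move: (x0 k); rewrite mxE;
  by rewrite mulf_eq0 negb_or y0.
Qed.

(** Translation by [y] permutes the torus, so the sum equals [psi y] times itself, and [psi y] is
    not 1. *)
Lemma sum_torus_character (psi : 'rV[K]_n -> K) y :
    {in torus K n &, {morph psi : x z / torus_mul x z >-> x * z}} ->
    y \in torus K n -> psi y != 1 ->
  \sum_(x in torus K n) psi x = 0.
Proof.
move=> psiM Ty psiy; have /torusP y0 := Ty.
pose g x : 'rV[K]_n := \row_k ((y 0 k)^-1 * x 0 k).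
have sumE : \sum_(x in torus K n) psi x = psi y * \sum_(x in torus K n) psi x.
  rewrite [LHS](reindex (torus_mul y)) /=; last first.
    by exists g => x _; apply/rowP => k; rewrite !mxE ?mulKf ?mulVKf.
  rewrite mulr_sumr; apply: eq_big => x; first by rewrite torus_mul_in.
  by rewrite torus_mul_in // => Tx; rewrite psiM.
apply/eqP; move/eqP: sumE; rewrite -subr_eq0 -{1}[\sum_(_ in _) _]mul1r -mulrBl.
by rewrite mulf_eq0 subr_eq0 eq_sym (negbTE psiy).
Qed.

(** The translation by 1 permutes [K], yet adds [#|K|] to the sum of all elements. *)
Lemma card_finField_natr : #|K|%:R = 0 :> K.
Proof.
have: \sum_(x : K) x = \sum_(x : K) x + #|K|%:R.
  rewrite {1}(reindex_inj (addIr 1)) big_split /=; congr (_ + _).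
  by rewrite sumr_const.
by move/eqP; rewrite -subr_eq0 opprD addNKr oppr_eq0 => /eqP.
Qed.

(** The order is $(q-1)^n$, which is $(-1)^n$ in [K]. Hence it can be cancelled in the orthogonality
    argument. *)
Lemma card_torus_natr_neq0 : #|torus K n|%:R != 0 :> K.
Proof.
have -> : #|torus K n| = (#|K|.-1 ^ n)%N.
  pose h (f : {ffun 'I_n -> K}) : 'rV[K]_n := \row_k f k.
  have h_inj : injective h.
    by move=> f g /rowP fg; apply/ffunP => k; move: (fg k); rewrite !mxE.
  rewrite -(cardC1 (0 : K)) -[X in (_ ^ X)%N](card_ord n) -card_ffun_on.
  rewrite -(card_imset _ h_inj).
  apply: eq_card => x; apply/torusP/imsetP => [x0|[f /ffun_onP f0 ->] k].
    exists [ffun k => x 0 k]; last by apply/rowP => k; rewrite mxE ffunE.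
    by apply/ffun_onP => k; rewrite ffunE; apply: x0.
  by rewrite mxE; apply: f0.
rewrite natrX expf_neq0 // -subn1 natrB; last by apply/card_gt0P; exists 0.
by rewrite card_finField_natr sub0r oppr_eq0 oner_eq0.
Qed.

End Torus.

(** * Monomials as characters of the torus *)

Section ToricSet.
Variables (K : finFieldType) (n s : nat) (nu : 'I_s -> 'X_{1..n}).
Implicit Types (x : 'rV[K]_n) (a b m : 'X_{1..s}) (f : {mpoly K[s]}).

Definition torus_char m x : K :=
  ('X_[m] : {mpoly K[s]}).@[fun i => toric_vector nu x 0 i].

Lemma torus_charD a b x :
  torus_char (a + b)%MM x = torus_char a x * torus_char b x.
Proof. by rewrite /torus_char mpolyXD mevalM. Qed.

Lemma toric_vector_neq0 x i : x \in torus K n -> toric_vector nu x 0 i != 0.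
Proof.
by move/torusP=> x0; rewrite mxE; apply/prodf_neq0 => k _; rewrite expf_neq0.
Qed.

Lemma torus_char_neq0 m x : x \in torus K n -> torus_char m x != 0.
Proof.
move=> Tx; rewrite /torus_char mevalX; apply/prodf_neq0 => i _.
by rewrite expf_neq0 // toric_vector_neq0.
Qed.

Lemma torus_char_morph m :
  {morph torus_char m : x y / torus_mul _ _ x y >-> x * y}.
Proof.
move=> x y; rewrite /torus_char !mevalX -big_split; apply: eq_bigr => i _ /=.
rewrite -exprMn !mxE -big_split; congr (_ ^+ _); apply: eq_bigr => k _ /=.
by rewrite mxE exprMn.
Qed.

(** For exponents of equal degree this says that $t^a - t^b$ vanishes on $X$. *)
Definition same_char a b :=
  [forall x in torus K n, torus_char a x == torus_char b x].

Lemma same_charP a b :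
  reflect {in torus K n, torus_char a =1 torus_char b} (same_char a b).
Proof. exact: eqfun_inP. Qed.

Lemma same_char_addr c a b :
  same_char (a + c)%MM (b + c)%MM = same_char a b.
Proof.
apply/same_charP/same_charP => ab x Tx; move: (ab x Tx); rewrite !torus_charD.
  by move/mulIf; apply; apply: torus_char_neq0.
by move->.
Qed.

Lemma vanishes_on_toric_set f x :
  vanishes_on (toric_set K nu) f -> x \in torus K n ->
  f.@[fun i => toric_vector nu x 0 i] = 0.
Proof.
move=> f0 Tx; apply: (f0 (proj_class (toric_vector nu x))).
  by apply/imsetP; exists x.
by apply/imsetP; exists 1; rewrite ?inE ?oner_eq0 ?scale1r.
Qed.

Lemma vanishes_on_binomial a b :
    mdeg a = mdeg b -> same_char a b ->
  vanishes_on (toric_set K nu) ('X_[a] - 'X_[b]).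
Proof.
move=> dab /same_charP ab _ /imsetP[x Tx ->] _ /imsetP[c c0 ->].
(* Changing the representative by [c] multiplies a monomial by a power of [c] that depends only on
   its degree. *)
have scaleE m : ('X_[m] : {mpoly K[s]}).@[fun i => (c *: toric_vector nu x) 0 i]
    = c ^+ mdeg m * torus_char m x.
  rewrite /torus_char !mevalX mdegE -prodrXr -big_split; apply: eq_bigr => i _.
  by rewrite mxE exprMn.
by rewrite mevalB !scaleE dab ab // subrr.
Qed.

(** Orthogonality of characters: divide the values of [f] by those of [m0] and sum over the torus.
    Only the monomials with the character of [m0] survive, each contributing its coefficient times
    the order of the torus. *)
Lemma sum_coeff_same_char f m0 :
    vanishes_on (toric_set K nu) f ->
  \sum_(m <- msupp f | same_char m m0) f@_m = 0.
Proof.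
move=> f0; pose psi m x := torus_char m x / torus_char m0 x.
have psi_sum m : \sum_(x in torus K n) psi m x =
    if same_char m m0 then #|torus K n|%:R else 0.
  case: ifP => [/same_charP mm0|/forall_inP].
    rewrite -sumr_const; apply: eq_bigr => x Tx.
    by rewrite /psi mm0 // divff // torus_char_neq0.
  move/forall_inP; rewrite negb_forall_in => /exists_inP[y Ty my].
  apply: (@sum_torus_character _ _ _ y) => //.
    by move=> x z _ _; rewrite /psi !torus_char_morph invfM mulrACA.
  by apply: contraNneq my => /divr1_eq ->.
apply: (mulIf (card_torus_natr_neq0 K n)); rewrite mul0r mulr_suml.
rewrite big_mkcond /=.
(* The double sum of [f@_m * psi m x] is computed in both orders; summing over [m] first gives
   values of [f] on $X$, which are zero. *)
transitivity (\sum_(x in torus K n)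
    f.@[fun i => toric_vector nu x 0 i] / torus_char m0 x); last first.
  by rewrite big1 // => x Tx; rewrite vanishes_on_toric_set ?mul0r.
transitivity (\sum_(m <- msupp f) \sum_(x in torus K n) f@_m * psi m x).
  by apply: eq_bigr => m _; rewrite -mulr_sumr psi_sum; case: ifP; rewrite ?mulr0.
rewrite exchange_big /=; apply: eq_bigr => x Tx.
rewrite [in RHS](mpolyE f) raddf_sum mulr_suml; apply: eq_bigr => m _ /=.
by rewrite mevalZ mulrA.
Qed.

(** Replacing each monomial by a fixed one with the same character turns [f] into 0, because the
    coefficients in each class add up to 0. So [f] is the sum of the differences. *)
Lemma ideal_gen_binomials f d (G : {mpoly K[s]} -> Prop) :
    f \is d.-homog -> vanishes_on (toric_set K nu) f ->
    (forall a b, mdeg a = mdeg b -> same_char a b ->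
       ideal_gen G ('X_[a] - 'X_[b])) ->
  ideal_gen G f.
Proof.
move=> /dhomogP fd f0 GB.
(* Extension by zero off the torus turns [same_char] into equality in a finite type, over which the
   monomials can be partitioned. *)
pose chi m : {ffun 'rV[K]_n -> K} :=
  [ffun x => if x \in torus K n then torus_char m x else 0].
have chiE a b : (chi a == chi b) = same_char a b.
  apply/eqP/same_charP => [/ffunP ab x Tx|ab].
    by move: (ab x); rewrite !ffunE Tx.
  by apply/ffunP => x; rewrite !ffunE; case: ifP => // /ab.
(* The default [0%MM] occurs as a fallback only when no monomial of [f] has character [c]; the sum
   over such a class is empty. *)
pose rep c := head 0%MM [seq m <- msupp f | chi m == c].
have repP m : m \in msupp f -> rep (chi m) \in msupp f /\ chi (rep (chi m)) == chi m.
  move=> mf; have: m \in [seq m' <- msupp f | chi m' == chi m].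
    by rewrite mem_filter eqxx.
  have: {subset [seq m' <- msupp f | chi m' == chi m] <=
          [pred m' | (m' \in msupp f) && (chi m' == chi m)]}.
    by move=> m'; rewrite mem_filter inE andbC.
  rewrite /rep; case: (filter _ _) => // m' r sub _ /=.
  by apply/andP; apply: sub; rewrite mem_head.
have repsum0 : \sum_(m <- msupp f) f@_m *: 'X_[rep (chi m)] = 0 :> {mpoly K[s]}.
  rewrite (partition_big chi xpredT) //= big1 // => c _.
  rewrite (eq_bigr (fun m => f@_m *: 'X_[rep c])) => [|m /eqP-> //].
  rewrite -scaler_suml.
  case: (boolP (has (fun m => chi m == c) (msupp f))) => [|/hasPn nc]; last first.
    by rewrite big_seq_cond big_pred0 ?scale0r // => m; apply/andP=> -[/nc/negP].
  case/hasP => m0 _ /eqP <-; under eq_bigl do rewrite chiE.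
  by rewrite sum_coeff_same_char ?scale0r.
have -> : f = \sum_(m <- msupp f) (f@_m *: 'X_[m] - f@_m *: 'X_[rep (chi m)]).
  by rewrite sumrB repsum0 subr0 -mpolyE.
apply: ideal_gen_sum => m mf; have [rf rm] := repP m mf.
rewrite -scalerBr -mul_mpolyC; apply: ideal_genM; apply: GB.
  by rewrite !fd.
by rewrite -chiE eq_sym.
Qed.

(** * The finite list of reduced binomials *)

Definition bounded_mnm k (u : {ffun 'I_s -> 'I_k.+1}) : 'X_{1..s} :=
  [multinom (u i : nat) | i < s].

(** There are infinitely many exponents in general, so the bounded ones are enumerated through
    functions into ['I_k.+1]. *)
Definition reduced_pairs k :=
  [seq (bounded_mnm k p.1, bounded_mnm k p.2) |
     p <- enum [set: {ffun 'I_s -> 'I_k.+1} * {ffun 'I_s -> 'I_k.+1}]].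

Lemma mem_reduced_pairs k a b :
  ((a, b) \in reduced_pairs k) = [forall i, (a i <= k)%N && (b i <= k)%N].
Proof.
apply/mapP/forallP => [[[u v] _ [-> ->]] i|abk].
  by rewrite !mnmE -ltnS ltn_ord -ltnS ltn_ord.
exists ([ffun i => inord (a i)], [ffun i => inord (b i)]).
  by rewrite mem_enum inE.
by congr (_, _); apply/mnmP => i; rewrite mnmE ffunE inordK // ltnS;
  case/andP: (abk i).
Qed.

Definition reduced_binomials : seq {mpoly K[s]} :=
  [seq 'X_[p.1] - 'X_[p.2] | p <- reduced_pairs (#|K| - 2) &
     [&& mdeg p.1 == mdeg p.2, same_char p.1 p.2 &
         supp p.1 :&: supp p.2 == set0]].

Lemma reduced_binomialsP f :
  reflect (exists a b, [/\ f = 'X_[a] - 'X_[b], mdeg a = mdeg b, same_char a b,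
             supp a :&: supp b = set0 &
             forall i, (a i <= #|K| - 2)%N && (b i <= #|K| - 2)%N])
          (f \in reduced_binomials).
Proof.
apply: (iffP mapP) => [[[a b]]|[a [b [-> dab cab sab ab]]]].
  rewrite mem_filter mem_reduced_pairs => /andP[/and3P[/eqP d c /eqP sab]].
  by move=> /forallP ab ->; exists a, b.
exists (a, b) => //; rewrite mem_filter mem_reduced_pairs /= dab cab sab !eqxx.
exact/forallP.
Qed.

(** * Descent to the reduced binomials *)

Local Notation generators :=
  (fun g => toric_relation g \/ g \in reduced_binomials).

Lemma supp_disjoint a b :
  (forall i, a i != 0 -> b i = 0)%N -> supp a :&: supp b = set0.
Proof.
move=> ab; apply/setP => i; rewrite !inE; apply/andP => -[/ab ->].
by rewrite eqxx.
Qed.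

(** Both characters are trivial, since $u^{q-1} = 1$ for every nonzero $u$ in [K]. *)
Lemma same_char_toric (i j : 'I_s) :
  same_char (U_(i) *+ (#|K| - 1))%MM (U_(j) *+ (#|K| - 1))%MM.
Proof.
have fermat (u : K) : u != 0 -> u ^+ (#|K| - 1) = 1.
  move=> u0; apply: (mulfI u0); rewrite -exprS subn1 prednK ?expf_card ?mulr1 //.
  by apply/card_gt0P; exists 0.
apply/same_charP => x Tx; rewrite /torus_char -!mpolyXn !rmorphXn /= !mevalXU.
by rewrite !fermat ?toric_vector_neq0.
Qed.

Lemma binomial_in_ideal a b :
  mdeg a = mdeg b -> same_char a b -> ideal_gen generators ('X_[a] - 'X_[b]).
Proof.
have [N] := ubnP (mdeg a); elim: N a b => // N IHN a b; rewrite ltnS => aN dab cab.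
(* A common variable is factored out; the degree drops by one and the induction hypothesis
   applies. *)
have cancel i a' b' : (mdeg a' <= N)%N -> mdeg a' = mdeg b' -> same_char a' b' ->
    a' i != 0%N -> b' i != 0%N -> ideal_gen generators ('X_[a'] - 'X_[b']).
  move=> + + + ai bi; rewrite -(submK (m := U_(i)) (m' := a')) ?lep1mP //.
  rewrite -(submK (m := U_(i)) (m' := b')) ?lep1mP //.
  rewrite !mdegD !mdeg1 !addn1 same_char_addr => a'N [d c].
  by rewrite !mpolyXD -mulrBl mulrC; apply/ideal_genM/IHN.
have lower a' b' i : (mdeg a' <= N)%N -> mdeg a' = mdeg b' -> same_char a' b' ->
    (#|K| - 2 < a' i)%N -> ideal_gen generators ('X_[a'] - 'X_[b']).
  move=> a'N d c ai; have qai : (#|K| - 1 <= a' i)%N.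
    by apply: leq_trans ai; rewrite leq_subLR add1n -add2n -leq_subLR.
  (* Otherwise [b'] would have degree 0, hence [a'] too, against the large exponent at [i]. *)
  have [j bj] : exists j, b' j != 0%N.
    apply/existsP; apply: contraLR ai => /existsPn b0; rewrite -leqNgt.
    have /eqP : mdeg a' = 0%N.
      by rewrite d mdegE big1 // => j _; move: (b0 j); rewrite negbK => /eqP.
    by rewrite mdeg_eq0 => /eqP->; rewrite mnm0E.
  pose a0 := (a' - U_(i) *+ (#|K| - 1))%MM.
  (* Trading $t_i^{q-1}$ for $t_j^{q-1}$ keeps the degree and the character, and makes $t_j$ a
     common variable because $q-1 > 0$. *)
  pose a1 := (a0 + U_(j) *+ (#|K| - 1))%MM.
  have a'E : a' = (a0 + U_(i) *+ (#|K| - 1))%MM.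
    rewrite submK //; apply/mnm_lepP => l; rewrite mulmnE mnm1E.
    by case: eqP => [<-|]; rewrite ?mul1n.
  have da1 : mdeg a1 = mdeg a' by rewrite a'E !mdegD !mdegMn !mdeg1.
  have ca1 : same_char a1 b'.
    apply/same_charP => x Tx; rewrite -(same_charP _ _ c) // a'E !torus_charD.
    by congr (_ * _); apply: (same_charP _ _ (same_char_toric j i)).
  have -> : 'X_[a'] - 'X_[b'] =
      'X_[a0] * ('X_i ^+ (#|K| - 1) - 'X_j ^+ (#|K| - 1)) + ('X_[a1] - 'X_[b'])
      :> {mpoly K[s]}.
    by rewrite mulrBr !mpolyXn -!mpolyXD -a'E addrA subrK.
  apply: ideal_genD.
    by apply/ideal_genM/mem_ideal_gen; left; exists i, j.
  apply: (cancel j); rewrite ?da1 // mnmDE mulmnE mnm1E eqxx mul1n addn_eq0.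
  by rewrite negb_and -[X in _ || X]lt0n subn_gt0 finNzRing_gt1 orbT.
case: (boolP [exists i, (a i != 0) && (b i != 0)]%N) => [|/existsPn disj].
  by case/existsP => i /andP[ai bi]; apply: (cancel i).
case: (boolP [exists i, #|K| - 2 < a i]%N) => [/existsP[i]|/existsPn ak].
  exact: lower.
case: (boolP [exists i, #|K| - 2 < b i]%N) => [/existsP[i]|/existsPn bk].
  (* A large exponent in [b] is handled by symmetry, up to sign. *)
  rewrite -opprB => bi; apply/ideal_genN/(lower _ _ i) => //; first by rewrite -dab.
  by apply/same_charP => x Tx; rewrite (same_charP _ _ cab).
apply/mem_ideal_gen; right; apply/reduced_binomialsP; exists a, b; split => //.
  by apply: supp_disjoint => i ai; move: (disj i); rewrite ai negbK => /eqP.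
by move=> i; move: (ak i) (bk i); rewrite -!leqNgt => -> ->.
Qed.

(** * Homogeneity and partial degrees of binomials *)

Lemma homogeneous_binomial a b :
  mdeg a = mdeg b -> homogeneous ('X_[a] - 'X_[b] : {mpoly K[s]}).
Proof.
by move=> dab; exists (mdeg a); apply: rpredB; rewrite dhomogX; apply/eqP.
Qed.

Lemma degree_in_binomial k i a b : (a i <= k)%N -> (b i <= k)%N ->
  (degree_in i ('X_[a] - 'X_[b] : {mpoly K[s]}) <= k)%N.
Proof.
move=> ak bk; apply/bigmax_leqP_seq => m /msuppB_le + _.
by rewrite mem_cat !msuppX !inE => /orP[]/eqP->.
Qed.

End ToricSet.

Theorem theorem4p5 (K : finFieldType) (n s : nat) (nu : 'I_s -> 'X_{1..n})
    (K_gt2 : (2 < #|K|)%N) (s_gt0 : (0 < s)%N) :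
  exists B : seq {mpoly K[s]},
    (forall f : {mpoly K[s]}, f \in B ->
       exists a b : 'X_{1..s},
         [/\ f = 'X_[a] - 'X_[b],
             homogeneous f,
             supp a :&: supp b = set0
           & forall i : 'I_s, (degree_in i f <= #|K| - 2)%N]) /\
    (forall f : {mpoly K[s]},
       vanishing_ideal (toric_set K nu) f <->
       ideal_gen (fun g => toric_relation g \/ g \in B) f).
Proof.
exists (reduced_binomials K n s nu); split=> [f /reduced_binomialsP|f].
  move=> [a [b [-> dab _ sab ab]]]; exists a, b; split=> // [|i].
    exact: homogeneous_binomial.
  by case/andP: (ab i); apply: degree_in_binomial.
split; apply: ideal_gen_trans => g.
  by case=> -[d gd] g0; apply: ideal_gen_binomials gd g0 _ => a b;
  apply: binomial_in_ideal.
move=> gG; apply: mem_ideal_gen.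
(* Toric relations and reduced binomials are treated alike: each is a binomial with equal degrees
   and equal characters. *)
have [a [b [-> dab cab]]] : exists a b,
    [/\ g = 'X_[a] - 'X_[b], mdeg a = mdeg b & same_char K n s nu a b].
  case: gG => [[i [j ->]]|/reduced_binomialsP[a [b [-> dab cab _ _]]]].
    exists (U_(i) *+ (#|K| - 1))%MM, (U_(j) *+ (#|K| - 1))%MM.
    by rewrite !mpolyXn !mdegMn !mdeg1; split=> //; apply: same_char_toric.
  by exists a, b.
by split; [apply: homogeneous_binomial | apply: vanishes_on_binomial].
Qed.
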